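(* Let $G$ be a finite group. For every $\omega\in Z^3(G,U(1))$, the map $\operatorname{Hom}(G,\widehat G)\to\operatorname{Aut}_{\mathrm{rigid}}(\mathcal D^\omega(G))$ given by $r\mapsto(0,1,r,1)$ is an injective group homomorphism. As a consequence, there is an injective group homomorphism $$\operatorname{Hom}(G,\widehat G)\to\bigcap_{\omega\in Z^3(G,U(1))}\operatorname{Aut}(\mathcal D^\omega(G)).$$
   Context: All algebras are over $\mathbb C$. $\mathbb CG$ is the group Hopf algebra and $\mathbb C^G$ its dual with dual basis $(e_g)$, unit $\varepsilon=\sum_ge_g$, counit $\mathrm{ev}_1(e_g)=\delta_{g,1}$. $\widehat G\subset\mathbb C^G$ is the group of one-dimensional characters of $G$, and $\operatorname{Hom}(G,\widehat G)$ is an abelian group under pointwise multiplication. $Z^3(G,U(1))$ is the set of normalized 3-cocycles: functions $\omega\colon G^3\to U(1)$ with $\omega(g,1,h)=1$ and $\omega(a,b,c)\omega(a,bc,d)\omega(b,c,d)=\omega(ab,c,d)\omega(a,b,cd)$. Put $$\theta_g(x,y)=\frac{\omega(g,x,y)\,\omega(x,y,(xy)^{-1}gxy)}{\omega(x,x^{-1}gx,y)},\qquad \gamma_x(g,h)=\frac{\omega(g,h,x)\,\omega(x,x^{-1}gx,x^{-1}hx)}{\omega(g,x,x^{-1}hx)}.$$ The twisted double $\mathcal D^\omega(G)$ is the quasi-Hopf algebra with underlying space $\mathbb C^G\otimes\mathbb CG$, basis $e_g\#x$, multiplication $(e_g\#x)(e_h\#y)=\delta_{g,xhx^{-1}}\theta_g(x,y)e_g\#xy$,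 unit $\varepsilon\#1$, comultiplication $\Delta(e_g\#x)=\sum_t\gamma_x(gt^{-1},t)e_{gt^{-1}}\#x\otimes e_t\#x$, counit $\mathrm{ev}_1\otimes\varepsilon$, coassociator $\sum_{a,b,c}\omega(a,b,c)^{-1}e_a\#1\otimes e_b\#1\otimes e_c\#1$, antipode $S(e_g\#x)=\theta_{g^{-1}}(x,x^{-1})^{-1}\gamma_x(g,g^{-1})^{-1}e_{x^{-1}g^{-1}x}\#x^{-1}$, $\alpha=1$, $\beta=\sum_g\omega(g,g^{-1},g)e_g\#1$. $\mathcal D(G)=\mathcal D^1(G)$ is the untwisted double. $\operatorname{Aut}(\mathcal D^\omega(G))$ is the group of quasi-Hopf algebra automorphisms: linear bijections that are unital algebra morphisms, respect comultiplication, counit, coassociator and antipode, and fix $\alpha$ and $\beta$. All these groups, for varying $\omega$, are regarded as groups of linear automorphisms of the single space $\mathbb C^G\otimes\mathbb CG$. $\operatorname{Aut}_{\mathrm{rigid}}(\mathcal D^\omega(G))$ is the group of quasi-bialgebra automorphisms (algebra automorphisms respecting comultiplication, counit, coassociator) of $\mathcal D^\omega(G)$ which are also Hopf algebra automorphisms of $\mathcal D(G)$; group operations are composition. For $r\in\operatorname{Hom}(G,\widehat G)$, $(0,1,r,1)$ denotes the linear map $e_g\#x\mapsto e_g\,r(x)\#x$, where $e_g\,r(x)$ is the product in $\mathbb C^G$. *)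

(* Defs.v *)
From HB Require Import structures.
From mathcomp Require Import all_boot all_order all_algebra all_fingroup.
From mathcomp Require Import complex.
From mathcomp Require Import boolp reals.

Set Implicit Arguments.
Unset Strict Implicit.
Unset Printing Implicit Defensive.

Import Order.TTheory GRing.Theory Num.Theory.

Local Open Scope ring_scope.

(** * Complex vector spaces with a chosen finite basis

    [vsp R X] is the complex vector space with basis indexed by [X]. The tensor
    product of [vsp R X] and [vsp R Y] is [vsp R (X * Y)], with
    [bvec x] ⊗ [bvec y] identified with [bvec (x, y)]. *)

Notation vsp R X := ({ffun X -> (R[i])^o}) (only parsing).

Section FreeSpaces.
Variable R : realType.

Definition bvec (X : finType) (x : X) : vsp R X := [ffun y => (y == x)%:R].

(* The linear map sending [bvec x] to [F x]. *)
Definition linext (X : finType) (W : lmodType R[i]) (F : X -> W)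
  (u : vsp R X) : W := \sum_(x : X) u x *: F x.

Lemma linext_is_linear (X : finType) (W : lmodType R[i]) (F : X -> W) :
  linear (linext F).
Proof.
move=> a u v; rewrite /linext scaler_sumr -big_split /=.
by apply: eq_bigr => x _; rewrite !ffunE scalerDl scalerA.
Qed.

HB.instance Definition _ (X : finType) (W : lmodType R[i]) (F : X -> W) :=
  GRing.isLinear.Build R[i] (vsp R X) W *:%R (linext F) (linext_is_linear F).

(* The bilinear map sending [(bvec x, bvec y)] to [F x y]. *)
Definition bilinext (X Y : finType) (W : lmodType R[i]) (F : X -> Y -> W)
  (u : vsp R X) (v : vsp R Y) : W := linext (fun x => linext (F x) v) u.

Definition tens (X Y : finType) (u : vsp R X) (v : vsp R Y) :
    vsp R (X * Y)%type :=
  [ffun p => u p.1 * v p.2].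

Definition tensmap (X Y X' Y' : finType)
    (f : vsp R X -> vsp R X') (g : vsp R Y -> vsp R Y') :
    vsp R (X * Y)%type -> vsp R (X' * Y')%type :=
  linext (fun p => tens (f (bvec p.1)) (g (bvec p.2))).

Lemma linext_bvec (X : finType) (W : lmodType R[i]) (F : X -> W) x :
  linext F (bvec x) = F x.
Proof.
rewrite /linext (bigD1 x) //= big1 => [|y /negPf neq_yx];
  by rewrite ffunE ?eqxx ?neq_yx ?scale1r ?scale0r ?addr0.
Qed.

Lemma bvec_sum (X : finType) (u : vsp R X) : u = \sum_x u x *: bvec x.
Proof.
apply/ffunP => y; rewrite sum_ffunE (bigD1 y) //= big1 => [|x /negPf neq_xy].
  by rewrite !ffunE eqxx addr0 /GRing.scale /= mulr1.
by rewrite !ffunE eq_sym neq_xy scaler0.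
Qed.

Lemma linear_ext (X : finType) (W : lmodType R[i])
    (f g : {linear vsp R X -> W}) :
  (forall x, f (bvec x) = g (bvec x)) -> f =1 g.
Proof.
move=> eq_fg u; rewrite (bvec_sum u) !linear_sum.
by apply: eq_bigr => x _; rewrite !linearZ /= eq_fg.
Qed.

Lemma tens_suml (X Y I : finType) (c : I -> R[i]) (w : I -> vsp R X)
    (v : vsp R Y) :
  tens (\sum_i c i *: w i) v = \sum_i c i *: tens (w i) v.
Proof.
apply/ffunP => p; rewrite ffunE !sum_ffunE mulr_suml.
by apply: eq_bigr => i _; rewrite !ffunE -scalerAl.
Qed.

Lemma tens_sumr (X Y I : finType) (c : I -> R[i]) (u : vsp R X)
    (w : I -> vsp R Y) :
  tens u (\sum_i c i *: w i) = \sum_i c i *: tens u (w i).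
Proof.
apply/ffunP => p; rewrite ffunE !sum_ffunE mulr_sumr.
by apply: eq_bigr => i _; rewrite !ffunE -scalerAr.
Qed.

Lemma tensmap_tens (X Y X' Y' : finType)
    (f : {linear vsp R X -> vsp R X'}) (g : {linear vsp R Y -> vsp R Y'}) u v :
  tensmap f g (tens u v) = tens (f u) (g v).
Proof.
have fE : f u = \sum_x u x *: f (bvec x).
  by rewrite {1}(bvec_sum u) linear_sum; apply: eq_bigr => x _; rewrite linearZ.
have gE : g v = \sum_y v y *: g (bvec y).
  by rewrite {1}(bvec_sum v) linear_sum; apply: eq_bigr => y _; rewrite linearZ.
rewrite fE gE tens_suml.
under [RHS]eq_bigr do rewrite tens_sumr scaler_sumr.
rewrite pair_bigA /= /tensmap /linext; apply: eq_bigr => -[x y] _ /=.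
by rewrite ffunE /= scalerA.
Qed.

Lemma bvec_pair (X Y : finType) (x : X) (y : Y) :
  bvec (x, y) = tens (bvec x) (bvec y).
Proof. by apply/ffunP => -[x' y']; rewrite !ffunE /= xpair_eqE -mulnb natrM. Qed.

Lemma tensmap_id (X Y : finType) (f : vsp R X -> vsp R X)
    (g : vsp R Y -> vsp R Y) :
  f =1 id -> g =1 id -> tensmap f g =1 id.
Proof.
move=> f1 g1; rewrite /tensmap.
apply: (@linear_ext _ _ (linext _) idfun) => -[x y].
by rewrite [LHS]linext_bvec /= f1 g1 -bvec_pair.
Qed.

Lemma tensmap_comp (X Y X1 Y1 X2 Y2 : finType)
    (f : vsp R X -> vsp R X2) (g : vsp R Y -> vsp R Y2)
    (f1 : vsp R X -> vsp R X1) (g1 : vsp R Y -> vsp R Y1)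
    (f2 : {linear vsp R X1 -> vsp R X2}) (g2 : {linear vsp R Y1 -> vsp R Y2}) :
  f =1 f2 \o f1 -> g =1 g2 \o g1 ->
  tensmap f g =1 tensmap f2 g2 \o tensmap f1 g1.
Proof.
move=> fE gE; rewrite /tensmap.
apply: (@linear_ext _ _ (linext _) (linext _ \o linext _)) => -[x y].
rewrite [LHS]linext_bvec /= fE gE linext_bvec.
exact: esym (tensmap_tens _ _ _ _).
Qed.

HB.instance Definition _ (X Y X' Y' : finType)
    (f : vsp R X -> vsp R X') (g : vsp R Y -> vsp R Y') :=
  GRing.Linear.copy (tensmap f g)
    (linext (fun p => tens (f (bvec p.1)) (g (bvec p.2)))).

End FreeSpaces.

(** * The group of linear automorphisms *)

Section GeneralLinear.
Variables (K : fieldType) (V : vectType K).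

Record linaut := LinAut { linaut_fun :> 'End(V); _ : `[< bijective linaut_fun >] }.

HB.instance Definition _ := [isSub for linaut_fun].
HB.instance Definition _ := [Choice of linaut by <:].

Lemma linaut_bij (f : linaut) : bijective f.
Proof. by case: f => f /= /asboolP. Qed.

Lemma linaut_ker0 (f : linaut) : lker f == 0%VS.
Proof. exact/lker0P/bij_inj/linaut_bij. Qed.

Lemma linaut1_subproof : `[< bijective (\1%VF : 'End(V)) >].
Proof. by apply/asboolP; exists id => v; rewrite lfunE. Qed.

Lemma linautM_subproof (f g : linaut) : `[< bijective (f \o g)%VF >].
Proof.
apply/asboolP; apply: (eq_bij (bij_comp (linaut_bij f) (linaut_bij g))).
by move=> v; rewrite lfunE.
Qed.

Lemma linautV_subproof (f : linaut) : `[< bijective (f^-1)%VF >].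
Proof.
apply/asboolP; exists f; [exact: lker0_lfunVK (linaut_ker0 f) |].
exact: lker0_lfunK (linaut_ker0 f).
Qed.

Definition linaut_one := LinAut linaut1_subproof.
Definition linaut_mul f g := LinAut (linautM_subproof f g).
Definition linaut_inv f := LinAut (linautV_subproof f).

Lemma linaut_mulA : associative linaut_mul.
Proof. by move=> f g h; apply: val_inj; rewrite /= comp_lfunA. Qed.
Lemma linaut_mul1 : left_id linaut_one linaut_mul.
Proof. by move=> f; apply: val_inj; rewrite /= comp_lfun1l. Qed.
Lemma linaut_mulr1 : right_id linaut_one linaut_mul.
Proof. by move=> f; apply: val_inj; rewrite /= comp_lfun1r. Qed.
Lemma linaut_mulV : left_inverse linaut_one linaut_inv linaut_mul.
Proof. by move=> f; apply: val_inj; rewrite /= lker0_compVf ?linaut_ker0. Qed.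
Lemma linaut_mulrV : right_inverse linaut_one linaut_inv linaut_mul.
Proof. by move=> f; apply: val_inj; rewrite /= lker0_compfV ?linaut_ker0. Qed.

HB.instance Definition _ := isGroup.Build linaut
  linaut_mulA linaut_mul1 linaut_mulr1 linaut_mulV linaut_mulrV.

Lemma linaut1E v : (1%g : linaut) v = v.
Proof. by rewrite lfunE. Qed.
Lemma linautME (f g : linaut) v : (f * g)%g v = f (g v).
Proof. by rewrite lfunE. Qed.
Lemma linautVK (f : linaut) v : f ((f^-1)%g v) = v.
Proof. exact: lker0_lfunVK (linaut_ker0 f) v. Qed.
Lemma linautKV (f : linaut) v : (f^-1)%g (f v) = v.
Proof. exact: lker0_lfunK (linaut_ker0 f) v. Qed.

Lemma linaut_group_closed (P : {pred linaut}) :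
  P 1%g -> (forall f g, P f -> P g -> P (f * g)%g) ->
  (forall f, P f -> P (f^-1)%g) -> group_closed P.
Proof. by move=> P1 PM PV; split=> // f g Pf Pg; apply: PM => //; apply: PV. Qed.

End GeneralLinear.

(** * Automorphisms of quasi-Hopf algebras *)

Section QuasiHopf.
Variables (R : realType) (X : finType).
Local Notation H := (vsp R X).

(* The structure maps of a quasi-Hopf algebra, without the axioms relating
   them: the notions of automorphism below depend on the data only. *)
Record qhopf_data := QHopfData {
  qh_mul : H -> H -> H;
  qh_one : H;
  qh_comul : H -> vsp R (X * X)%type;
  qh_counit : H -> R[i];
  qh_coassoc : vsp R (X * X * X)%type;
  qh_antipode : H -> H;
  qh_alpha : H;
  qh_beta : H }.

Variable A : qhopf_data.
Implicit Type f : linaut H.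

Definition algebra_morph f : Prop :=
  f (qh_one A) = qh_one A
  /\ forall u v, f (qh_mul A u v) = qh_mul A (f u) (f v).

Definition comul_morph f : Prop :=
  forall u, qh_comul A (f u) = tensmap f f (qh_comul A u).

Definition counit_morph f : Prop :=
  forall u, qh_counit A (f u) = qh_counit A u.

Definition coassoc_morph f : Prop :=
  tensmap (tensmap f f) f (qh_coassoc A) = qh_coassoc A.

Definition antipode_morph f : Prop :=
  forall u, f (qh_antipode A u) = qh_antipode A (f u).

Definition quasi_bialgebra_aut f : Prop :=
  [/\ algebra_morph f, comul_morph f, counit_morph f & coassoc_morph f].

Definition quasi_hopf_aut f : Prop :=
  [/\ quasi_bialgebra_aut f, antipode_morph f,
      f (qh_alpha A) = qh_alpha A & f (qh_beta A) = qh_beta A].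

Definition hopf_aut f : Prop :=
  [/\ algebra_morph f, comul_morph f, counit_morph f & antipode_morph f].

Lemma linaut_tensM f g :
  tensmap (f * g)%g (f * g)%g =1 tensmap f f \o tensmap g g.
Proof. by apply: tensmap_comp => v; rewrite linautME. Qed.

Lemma linaut_tens1 : tensmap (1%g : linaut H) (1%g : linaut H) =1 id.
Proof. by apply: tensmap_id => v; rewrite linaut1E. Qed.

Lemma linaut_tensK f : cancel (tensmap f f) (tensmap (f^-1)%g (f^-1)%g).
Proof. by move=> u; rewrite -[LHS]linaut_tensM mulVg linaut_tens1. Qed.

Lemma algebra_morph1 : algebra_morph 1%g.
Proof. by split=> [|u v]; rewrite !linaut1E. Qed.
Lemma algebra_morphM f g :
  algebra_morph f -> algebra_morph g -> algebra_morph (f * g)%g.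
Proof.
by move=> [f1 fM] [g1 gM]; split=> [|u v]; rewrite !linautME ?g1 ?f1 ?gM ?fM.
Qed.
Lemma algebra_morphV f : algebra_morph f -> algebra_morph (f^-1)%g.
Proof.
move=> [f1 fM]; split=> [|u v]; first by rewrite -[in LHS]f1 linautKV.
by rewrite -{1}[u](linautVK f) -{1}[v](linautVK f) -fM linautKV.
Qed.

Lemma comul_morph1 : comul_morph 1%g.
Proof. by move=> u; rewrite linaut1E linaut_tens1. Qed.
Lemma comul_morphM f g : comul_morph f -> comul_morph g -> comul_morph (f * g)%g.
Proof. by move=> fD gD u; rewrite linautME fD gD linaut_tensM. Qed.
Lemma comul_morphV f : comul_morph f -> comul_morph (f^-1)%g.
Proof. by move=> fD u; rewrite -{2}[u](linautVK f) fD linaut_tensK. Qed.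

Lemma counit_morph1 : counit_morph 1%g.
Proof. by move=> u; rewrite linaut1E. Qed.
Lemma counit_morphM f g :
  counit_morph f -> counit_morph g -> counit_morph (f * g)%g.
Proof. by move=> fe ge u; rewrite linautME fe ge. Qed.
Lemma counit_morphV f : counit_morph f -> counit_morph (f^-1)%g.
Proof. by move=> fe u; rewrite -fe linautVK. Qed.

Lemma coassoc_morph1 : coassoc_morph 1%g.
Proof.
by apply: tensmap_id => v; [apply: linaut_tens1 | apply: linaut1E].
Qed.
Lemma coassoc_tensM f g :
  tensmap (tensmap (f * g)%g (f * g)%g) (f * g)%g
    =1 tensmap (tensmap f f) f \o tensmap (tensmap g g) g.
Proof.
apply: tensmap_comp => v; first exact: linaut_tensM.
by rewrite linautME.
Qed.
Lemma coassoc_morphM f g :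
  coassoc_morph f -> coassoc_morph g -> coassoc_morph (f * g)%g.
Proof.
by move=> fP gP; rewrite /coassoc_morph coassoc_tensM /= gP fP.
Qed.
Lemma coassoc_morphV f : coassoc_morph f -> coassoc_morph (f^-1)%g.
Proof.
move=> fP; rewrite /coassoc_morph -{1}fP.
by rewrite -[LHS]coassoc_tensM mulVg coassoc_morph1.
Qed.

Lemma antipode_morph1 : antipode_morph 1%g.
Proof. by move=> u; rewrite !linaut1E. Qed.
Lemma antipode_morphM f g :
  antipode_morph f -> antipode_morph g -> antipode_morph (f * g)%g.
Proof. by move=> fS gS u; rewrite !linautME gS fS. Qed.
Lemma antipode_morphV f : antipode_morph f -> antipode_morph (f^-1)%g.
Proof. by move=> fS u; rewrite -{1}[u](linautVK f) -fS linautKV. Qed.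

Lemma quasi_bialgebra_aut1 : quasi_bialgebra_aut 1%g.
Proof.
split; [exact: algebra_morph1 | exact: comul_morph1 | exact: counit_morph1 |].
exact: coassoc_morph1.
Qed.
Lemma quasi_bialgebra_autM f g :
  quasi_bialgebra_aut f -> quasi_bialgebra_aut g -> quasi_bialgebra_aut (f * g)%g.
Proof.
move=> [f1 f2 f3 f4] [g1 g2 g3 g4]; split.
- exact: algebra_morphM.
- exact: comul_morphM.
- exact: counit_morphM.
- exact: coassoc_morphM.
Qed.
Lemma quasi_bialgebra_autV f :
  quasi_bialgebra_aut f -> quasi_bialgebra_aut (f^-1)%g.
Proof.
move=> [f1 f2 f3 f4]; split.
- exact: algebra_morphV.
- exact: comul_morphV.
- exact: counit_morphV.
- exact: coassoc_morphV.
Qed.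

Lemma quasi_hopf_aut1 : quasi_hopf_aut 1%g.
Proof.
split; [exact: quasi_bialgebra_aut1 | exact: antipode_morph1 | |];
  exact: linaut1E.
Qed.
Lemma quasi_hopf_autM f g :
  quasi_hopf_aut f -> quasi_hopf_aut g -> quasi_hopf_aut (f * g)%g.
Proof.
move=> [f1 f2 f3 f4] [g1 g2 g3 g4]; split; rewrite ?linautME ?g3 ?g4 //.
  exact: quasi_bialgebra_autM.
exact: antipode_morphM.
Qed.
Lemma quasi_hopf_autV f : quasi_hopf_aut f -> quasi_hopf_aut (f^-1)%g.
Proof.
move=> [f1 f2 f3 f4]; split.
- exact: quasi_bialgebra_autV.
- exact: antipode_morphV.
- by rewrite -[in LHS]f3 linautKV.
- by rewrite -[in LHS]f4 linautKV.
Qed.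

Lemma hopf_aut1 : hopf_aut 1%g.
Proof.
split; [exact: algebra_morph1 | exact: comul_morph1 | exact: counit_morph1 |].
exact: antipode_morph1.
Qed.
Lemma hopf_autM f g : hopf_aut f -> hopf_aut g -> hopf_aut (f * g)%g.
Proof.
move=> [f1 f2 f3 f4] [g1 g2 g3 g4]; split.
- exact: algebra_morphM.
- exact: comul_morphM.
- exact: counit_morphM.
- exact: antipode_morphM.
Qed.
Lemma hopf_autV f : hopf_aut f -> hopf_aut (f^-1)%g.
Proof.
move=> [f1 f2 f3 f4]; split.
- exact: algebra_morphV.
- exact: comul_morphV.
- exact: counit_morphV.
- exact: antipode_morphV.
Qed.

End QuasiHopf.

(** * One-dimensional characters and the group Hom(G, Ĝ) *)

Section Characters.
Variables (R : realType) (gT : finGroupType).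

Definition is_linchar (chi : {ffun gT -> R[i]}) : bool :=
  (chi 1%g == 1) && [forall x, forall y, chi (x * y)%g == chi x * chi y].

Record linchar := LinChar {
  linchar_fun :> {ffun gT -> R[i]}; _ : is_linchar linchar_fun }.

HB.instance Definition _ := [isSub for linchar_fun].
HB.instance Definition _ := [Choice of linchar by <:].

Lemma is_lincharP (chi : {ffun gT -> R[i]}) :
  reflect (chi 1%g = 1 /\ forall x y, chi (x * y)%g = chi x * chi y)
          (is_linchar chi).
Proof.
apply: (iffP andP) => [[/eqP c1 /forallP cM]|[c1 cM]]; split=> //.
- by move=> x y; apply/eqP/(forallP (cM x)).
- exact/eqP.
- by apply/forallP=> x; apply/forallP=> y; apply/eqP.
Qed.

Lemma linchar1 (chi : linchar) : chi 1%g = 1.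
Proof. by case/is_lincharP: (valP chi). Qed.
Lemma lincharM (chi : linchar) x y : chi (x * y)%g = chi x * chi y.
Proof. by case/is_lincharP: (valP chi). Qed.
Lemma linchar_neq0 (chi : linchar) x : chi x != 0.
Proof.
apply/eqP => cx0; have := linchar1 chi.
by rewrite -(mulgV x) lincharM cx0 mul0r => /eqP; rewrite eq_sym oner_eq0.
Qed.

Lemma linchar_one_subproof : is_linchar [ffun=> 1].
Proof. by apply/is_lincharP; split=> [|x y]; rewrite !ffunE ?mulr1. Qed.
Lemma linchar_mul_subproof (chi psi : linchar) :
  is_linchar [ffun x => chi x * psi x].
Proof.
apply/is_lincharP; split=> [|x y]; rewrite !ffunE ?linchar1 ?mulr1 //.
by rewrite !lincharM mulrACA.
Qed.
Lemma linchar_inv_subproof (chi : linchar) : is_linchar [ffun x => (chi x)^-1].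
Proof.
apply/is_lincharP; split=> [|x y]; rewrite !ffunE ?linchar1 ?invr1 //.
by rewrite lincharM invfM.
Qed.

Definition linchar_one := LinChar linchar_one_subproof.
Definition linchar_mul chi psi := LinChar (linchar_mul_subproof chi psi).
Definition linchar_inv chi := LinChar (linchar_inv_subproof chi).

Lemma linchar_mulA : associative linchar_mul.
Proof.
by move=> a b c; apply: val_inj; apply/ffunP=> x; rewrite !ffunE mulrA.
Qed.
Lemma linchar_mulC : commutative linchar_mul.
Proof.
by move=> a b; apply: val_inj; apply/ffunP=> x; rewrite !ffunE mulrC.
Qed.
Lemma linchar_mul1 : left_id linchar_one linchar_mul.
Proof.
by move=> a; apply: val_inj; apply/ffunP=> x; rewrite !ffunE mul1r.
Qed.
Lemma linchar_mulr1 : right_id linchar_one linchar_mul.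
Proof. by move=> a; rewrite linchar_mulC linchar_mul1. Qed.
Lemma linchar_mulV : left_inverse linchar_one linchar_inv linchar_mul.
Proof.
move=> a; apply: val_inj; apply/ffunP=> x; rewrite !ffunE.
by rewrite mulVf ?linchar_neq0.
Qed.
Lemma linchar_mulrV : right_inverse linchar_one linchar_inv linchar_mul.
Proof. by move=> a; rewrite linchar_mulC linchar_mulV. Qed.

HB.instance Definition _ := isGroup.Build linchar
  linchar_mulA linchar_mul1 linchar_mulr1 linchar_mulV linchar_mulrV.

(* Group homomorphisms from G to Ĝ, as a subgroup of the group of all functions
   from G to Ĝ under pointwise multiplication. *)
Definition is_charhom (r : {ffun gT -> linchar}) : bool :=
  [forall x, forall y, r (x * y)%g == (r x * r y)%g].

Record charhom := CharHom {
  charhom_fun :> {ffun gT -> linchar}; _ : is_charhom charhom_fun }.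

HB.instance Definition _ := [isSub for charhom_fun].
HB.instance Definition _ := [Choice of charhom by <:].

Lemma is_charhomP (r : {ffun gT -> linchar}) :
  reflect (forall x y, r (x * y)%g = (r x * r y)%g) (is_charhom r).
Proof.
apply: (iffP forallP) => [rM x y|rM x]; first exact/eqP/(forallP (rM x)).
by apply/forallP=> y; apply/eqP.
Qed.

Lemma charhom_group_closed : group_closed is_charhom.
Proof.
split=> [|r s /is_charhomP rM /is_charhomP sM]; apply/is_charhomP=> x y.
  by rewrite !ffunE mulg1.
rewrite !ffunE rM sM; apply: val_inj; apply/ffunP=> z.
by rewrite !ffunE invfM mulrACA.
Qed.

HB.instance Definition _ :=
  SubChoice_isSubGroup.Build _ is_charhom charhom charhom_group_closed.

End Characters.

(** * Twisted Drinfeld doubles *)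

Section TwistedDouble.
Variables (R : realType) (gT : finGroupType).
Implicit Types (a b c d g h t x y : gT).

(* Z^3(G, U(1)), normalized in the middle argument. *)
Record cocycle3 := Cocycle3 {
  cocycle_fun :> gT -> gT -> gT -> R[i];
  cocycle_U1 : forall a b c, `|cocycle_fun a b c| = 1;
  cocycle_normalized : forall g h, cocycle_fun g 1%g h = 1;
  cocycle_eq : forall a b c d,
    cocycle_fun a b c * cocycle_fun a (b * c)%g d * cocycle_fun b c d
      = cocycle_fun (a * b)%g c d * cocycle_fun a b (c * d)%g }.

Lemma cocycle_one_subproof (a b c d : gT) :
  (1 : R[i]) * 1 * 1 = 1 * 1.
Proof. by rewrite !mulr1. Qed.

Definition cocycle_one : cocycle3 := @Cocycle3 (fun _ _ _ => 1)
  (fun _ _ _ => normr1 _) (fun _ _ => erefl) cocycle_one_subproof.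

(* The underlying space C^G ⊗ CG does not depend on the cocycle:
   [ebas g x] is e_g # x and [smash a x] is a # x. *)
Local Notation dbl := (vsp R (gT * gT)%type).

Definition ebas g x : dbl := bvec R (g, x).
Definition smash (a : {ffun gT -> R[i]}) x : dbl := \sum_g a g *: ebas g x.

Section Twist.
Variable w : gT -> gT -> gT -> R[i].

(* Recall that [g ^ x] is x^-1 g x. *)
Definition theta g x y : R[i] :=
  w g x y * w x y (g ^ (x * y))%g / w x (g ^ x)%g y.

Definition gamma x g h : R[i] :=
  w g h x * w x (g ^ x)%g (h ^ x)%g / w g x (h ^ x)%g.

Definition tdouble : qhopf_data R (gT * gT)%type := {|
  qh_mul := bilinext (fun p q : gT * gT =>
    let: (g, x) := p in let: (h, y) := q in
    ((g == x * h * x^-1)%g%:R * theta g x y) *: ebas g (x * y)%g);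
  qh_one := smash [ffun=> 1] 1%g;
  qh_comul := linext (fun p : gT * gT => let: (g, x) := p in
    \sum_t gamma x (g * t^-1)%g t *: tens (ebas (g * t^-1)%g x) (ebas t x));
  qh_counit := linext (W := (R[i])^o) (fun p : gT * gT => let: (g, x) := p in
    (g == 1%g)%:R);
  qh_coassoc := \sum_a \sum_b \sum_c
    (w a b c)^-1 *: tens (tens (ebas a 1%g) (ebas b 1%g)) (ebas c 1%g);
  qh_antipode := linext (fun p : gT * gT => let: (g, x) := p in
    ((theta (g^-1)%g x (x^-1)%g)^-1 * (gamma x g (g^-1)%g)^-1)
      *: ebas (g^-1 ^ x)%g (x^-1)%g);
  qh_alpha := smash [ffun=> 1] 1%g;
  qh_beta := smash [ffun g => w g (g^-1)%g g] 1%g |}.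

End Twist.

(* The untwisted double D(G). *)
Definition udouble : qhopf_data R (gT * gT)%type := tdouble cocycle_one.

(* The map (0, 1, r, 1). *)
Definition map01r1 (r : charhom R gT) : 'End(dbl) :=
  linfun (linext (fun p : gT * gT => let: (g, x) := p in
    smash ([ffun h => (h == g)%:R] * (r x : {ffun gT -> R[i]})) x)).

Section Groups.
Variable w : cocycle3.

Definition is_aut (f : linaut dbl) : bool := `[< quasi_hopf_aut (tdouble w) f >].

Definition is_rigid (f : linaut dbl) : bool :=
  `[< quasi_bialgebra_aut (tdouble w) f /\ hopf_aut udouble f >].

Lemma is_aut_closed : group_closed is_aut.
Proof.
apply: linaut_group_closed => [|f g|f].
- exact/asboolP/quasi_hopf_aut1.
- by move=> /asboolP fP /asboolP gP; apply/asboolP/quasi_hopf_autM.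
- by move=> /asboolP fP; apply/asboolP/quasi_hopf_autV.
Qed.

Lemma is_rigid_closed : group_closed is_rigid.
Proof.
apply: linaut_group_closed => [|f g|f].
- by apply/asboolP; split; [apply: quasi_bialgebra_aut1 | apply: hopf_aut1].
- move=> /asboolP[f1 f2] /asboolP[g1 g2]; apply/asboolP.
  by split; [apply: quasi_bialgebra_autM | apply: hopf_autM].
- move=> /asboolP[f1 f2]; apply/asboolP.
  by split; [apply: quasi_bialgebra_autV | apply: hopf_autV].
Qed.

Record aut_rigid := AutRigid { rigid_linaut :> linaut dbl; _ : is_rigid rigid_linaut }.

HB.instance Definition _ := [isSub for rigid_linaut].
HB.instance Definition _ := [Choice of aut_rigid by <:].
HB.instance Definition _ :=
  SubChoice_isSubGroup.Build _ is_rigid aut_rigid is_rigid_closed.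

End Groups.

Definition is_aut_all (f : linaut dbl) : bool :=
  `[< forall w : cocycle3, is_aut w f >].

Lemma is_aut_all_closed : group_closed is_aut_all.
Proof.
apply: linaut_group_closed => [|f g|f].
- apply/asboolP => w; exact: (proj1 (is_aut_closed w)).
- move=> /asboolP fP /asboolP gP; apply/asboolP => w.
  exact: (group_closedM (is_aut_closed w) (fP w) (gP w)).
- move=> /asboolP fP; apply/asboolP => w.
  exact: (group_closedV (is_aut_closed w) (fP w)).
Qed.

(* The intersection of the groups Aut(D^w(G)) over all cocycles w. *)
Record aut_all := AutAll { all_linaut :> linaut dbl; _ : is_aut_all all_linaut }.

HB.instance Definition _ := [isSub for all_linaut].
HB.instance Definition _ := [Choice of aut_all by <:].
HB.instance Definition _ :=
  SubChoice_isSubGroup.Build _ is_aut_all aut_all is_aut_all_closed.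

End TwistedDouble.

(* Main.v *)
From HB Require Import structures.
Require Import Defs.
From mathcomp Require Import all_boot all_order all_algebra all_fingroup.
From mathcomp Require Import complex boolp reals.

Set Implicit Arguments.
Unset Strict Implicit.
Unset Printing Implicit Defensive.

Import GRing.Theory.

Local Open Scope ring_scope.

(** The map [(0, 1, r, 1)] is diagonal: it multiplies [e_g # x] by [r(x)(g)].
    The structure maps of the twisted double send basis vectors to combinations
    of basis vectors whose index sets do not depend on the cocycle, so that
    compatibility with them only involves the weights [r(x)(g)]. These are
    multiplicative in [g] and in [x] and, [r(x)] being a class function,
    invariant under conjugation of [g]. *)

Section DiagonalMaps.
Variables (R : realType) (gT : finGroupType).
Implicit Types (r s : charhom R gT) (g h x y : gT) (chi : linchar R gT).
Local Notation dbl := (vsp R (gT * gT)%type).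

Lemma linchar_conjg chi g x : chi (g ^ x)%g = chi g.
Proof.
by rewrite conjgE !lincharM mulrC -mulrA -lincharM mulgV linchar1 mulr1.
Qed.

Lemma charhomM r x y g : r (x * y)%g g = r x g * r y g.
Proof. by have /is_charhomP -> := valP r; rewrite ffunE. Qed.

Lemma charhom1 r g : r 1%g g = 1.
Proof.
apply: (mulfI (linchar_neq0 (r 1%g) g)).
by rewrite -charhomM mulg1 mulr1.
Qed.

(** Needed for the antipode, which inverts both labels: the weight is multiplicative in each
    argument, so the two inversions cancel, and conjugation is invisible to a character. *)
Lemma charhom_antipode r x g : r x^-1%g (g^-1 ^ x)%g = r x g.
Proof.
apply: (mulfI (linchar_neq0 (r x) (g^-1 ^ x)%g)).
rewrite -charhomM mulgV charhom1 linchar_conjg -lincharM mulVg.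
by rewrite linchar1.
Qed.

Lemma tensZZ (X Y : finType) a b (u : vsp R X) (v : vsp R Y) :
  tens (a *: u) (b *: v) = (a * b) *: tens u v.
Proof. by apply/ffunP => p; rewrite !ffunE /GRing.scale /= mulrACA. Qed.

Lemma smash_delta (a : {ffun gT -> R[i]}) g x :
  smash ([ffun h => (h == g)%:R] * a) x = a g *: ebas R g x.
Proof.
rewrite /smash (bigD1 g) //= big1 => [|h /negPf neq_hg].
  by rewrite !ffunE eqxx mul1r addr0.
by rewrite !ffunE neq_hg mul0r scale0r.
Qed.

Lemma map01r1_ebas r g x : map01r1 r (ebas R g x) = r x g *: ebas R g x.
Proof. by rewrite lfunE [LHS]linext_bvec smash_delta. Qed.

Lemma map01r1E r (u : dbl) g x : map01r1 r u (g, x) = r x g * u (g, x).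
Proof.
(* From here on only linearity and the values on basis vectors are used. *)
have fE h y := map01r1_ebas r h y; move: (map01r1 r) fE => f fE.
rewrite {1}[u]bvec_sum linear_sum sum_ffunE (bigD1 (g, x)) //= big1.
  by rewrite linearZ /= fE !ffunE eqxx addr0 /GRing.scale /= mulr1 mulrC.
move=> [h y] /negPf neq; rewrite linearZ /= fE !ffunE eq_sym neq.
by rewrite !scaler0.
Qed.

Lemma map01r1M r s u : map01r1 (r * s)%g u = map01r1 r (map01r1 s u).
Proof.
by apply/ffunP => -[g x]; rewrite map01r1E [RHS]map01r1E map01r1E !ffunE mulrA.
Qed.

Lemma map01r1_1 u : map01r1 (1%g : charhom R gT) u = u.
Proof. by apply/ffunP => -[g x]; rewrite map01r1E !ffunE mul1r. Qed.

(** The number [r x g] is recovered as the eigenvalue at [ebas R g x]. *)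
Lemma map01r1_inj : injective (@map01r1 R gT).
Proof.
move=> r s eq_rs; apply/val_inj/ffunP => x; apply/val_inj/ffunP => g.
have := map01r1_ebas r g x; rewrite eq_rs map01r1_ebas.
by move/ffunP/(_ (g, x)); rewrite !ffunE eqxx /GRing.scale /= !mulr1.
Qed.

Lemma map01r1_bij r : `[< bijective (map01r1 r) >].
Proof.
(* The inverse map comes from the pointwise inverse of [r]. *)
apply/asboolP; exists (map01r1 r^-1%g) => v.
  by rewrite -map01r1M mulVg map01r1_1.
by rewrite -map01r1M mulgV map01r1_1.
Qed.

Definition diag_aut r : linaut dbl := LinAut (map01r1_bij r).

Lemma diag_autE r (u : dbl) g x : diag_aut r u (g, x) = r x g * u (g, x).
Proof. exact: map01r1E. Qed.

Lemma diag_autM r s : diag_aut (r * s)%g = (diag_aut r * diag_aut s)%g.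
Proof.
apply/val_inj/lfunP => u.
exact: etrans (map01r1M r s u) (esym (comp_lfunE _ _ _)).
Qed.

Lemma diag_aut_inj : injective diag_aut.
Proof. by move=> r s /(congr1 val)/map01r1_inj. Qed.

Section Diagonal.
Variables (r : charhom R gT) (f : linaut dbl).
Hypothesis fE : forall u g x, f u (g, x) = r x g * u (g, x).

Lemma diagonal_ebas g x : f (ebas R g x) = r x g *: ebas R g x.
Proof.
apply/ffunP => -[h y]; rewrite fE !ffunE.
by case: eqP => [[-> ->] //|_]; rewrite mulr0 scaler0.
Qed.

(** All weights at [x = 1] are 1. This covers the unit, [qh_alpha] and [qh_beta] at once. *)
Lemma diagonal_smash1 (a : {ffun gT -> R[i]}) :
  f (smash a 1%g) = smash a 1%g.
Proof.
rewrite linear_sum; apply: eq_bigr => g _.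
by rewrite linearZ /= diagonal_ebas charhom1 scale1r.
Qed.

Section Twist.
Variable w : gT -> gT -> gT -> R[i].

Lemma diagonal_algebra : algebra_morph (tdouble w) f.
Proof.
split=> [|u v]; first exact: diagonal_smash1.
rewrite /= /bilinext /linext linear_sum; apply: eq_bigr => -[g x] _.
rewrite fE linearZ /= [r x g * _]mulrC -scalerA; congr (_ *: _).
rewrite linear_sum scaler_sumr; apply: eq_bigr => -[h y] _.
rewrite fE !linearZ /= diagonal_ebas !scalerA; congr (_ *: _).
(* Off the support of the product both sides vanish. On it [g] is a conjugate of [h], so [r y] takes
   the same value at both and the two weights combine to that of [x * y]. *)
case: eqP => [->|_]; last by rewrite !mul0r !mulr0 ?mul0r.
rewrite charhomM.
have -> : r y (x * h * x^-1)%g = r y h.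
  by rewrite -[RHS](linchar_conjg _ _ x^-1%g) conjgE invgK mulgA.
by rewrite [r x _ * _]mulrC mulrCA !mulrA.
Qed.

Lemma diagonal_comul : comul_morph (tdouble w) f.
Proof.
rewrite /comul_morph /=.
apply: (@linear_ext _ _ _ (linext _ \o f) (tensmap _ _ \o linext _)).
move=> -[g x] /=; rewrite diagonal_ebas linearZ /= linext_bvec.
rewrite scaler_sumr [RHS]linear_sum; apply: eq_bigr => t _.
rewrite [RHS]linearZ /= tensmap_tens /= !diagonal_ebas tensZZ !scalerA.
(* The labels of the two legs multiply to [g], and [r x] is multiplicative. *)
by rewrite -lincharM mulgKV mulrC.
Qed.

Lemma diagonal_counit : counit_morph (tdouble w) f.
Proof.
rewrite /counit_morph /=.
apply: (@linear_ext _ _ _ (linext _ \o f) (linext _)).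
move=> -[g x] /=; rewrite diagonal_ebas linearZ /= !linext_bvec.
(* The counit only sees [g = 1], where the weight is 1. *)
by case: eqP => [->|_]; rewrite ?linchar1 ?scale1r ?scaler0.
Qed.

(** Every leg of the coassociator has group label 1, where [f] acts as the identity. *)
Lemma diagonal_coassoc : coassoc_morph (tdouble w) f.
Proof.
rewrite /coassoc_morph /= linear_sum; apply: eq_bigr => a _.
rewrite linear_sum; apply: eq_bigr => b _.
rewrite linear_sum; apply: eq_bigr => c _.
rewrite linearZ /= tensmap_tens /= tensmap_tens /=.
rewrite (diagonal_ebas a) (diagonal_ebas b) (diagonal_ebas c).
by rewrite !charhom1 !scale1r.
Qed.

Lemma diagonal_antipode : antipode_morph (tdouble w) f.
Proof.
rewrite /antipode_morph /=.
apply: (@linear_ext _ _ _ (f \o linext _) (linext _ \o f)).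
move=> -[g x] /=; rewrite diagonal_ebas linearZ /= !linext_bvec linearZ /=.
by rewrite diagonal_ebas charhom_antipode !scalerA mulrC.
Qed.

Lemma diagonal_quasi_bialgebra : quasi_bialgebra_aut (tdouble w) f.
Proof.
split; [exact: diagonal_algebra | exact: diagonal_comul | |].
  exact: diagonal_counit.
exact: diagonal_coassoc.
Qed.

Lemma diagonal_quasi_hopf : quasi_hopf_aut (tdouble w) f.
Proof.
split; [exact: diagonal_quasi_bialgebra | exact: diagonal_antipode | |];
  exact: diagonal_smash1.
Qed.

(** Taken at the trivial cocycle, this gives the condition on the untwisted double in rigidity. *)
Lemma diagonal_hopf : hopf_aut (tdouble w) f.
Proof.
split; [exact: diagonal_algebra | exact: diagonal_comul | |].
  exact: diagonal_counit.
exact: diagonal_antipode.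
Qed.

End Twist.

End Diagonal.

End DiagonalMaps.

Theorem corollary12p4 (R : realType) (gT : finGroupType) :
  (forall w : cocycle3 R gT,
     exists F : {multiplicative charhom R gT -> aut_rigid w},
       (forall r : charhom R gT, linaut_fun (F r) = map01r1 r)
       /\ injective F)
  /\ exists F : {multiplicative charhom R gT -> aut_all R gT}, injective F.
Proof.
split=> [w|].
  have rigidP r : is_rigid w (diag_aut r).
    apply/asboolP; split; first exact: diagonal_quasi_bialgebra (diag_autE r) _.
    exact: diagonal_hopf (diag_autE r) _.
  pose F r : aut_rigid w := AutRigid (rigidP r).
  have FM : {morph F : r s / (r * s)%g} by move=> r s; apply/val_inj/diag_autM.
  exists (HB.pack_for {multiplicative charhom R gT -> aut_rigid w} F
    (isMultiplicative.Build _ _ F FM)); split=> [r|].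
    exact: erefl.
  by move=> r s /(congr1 val)/diag_aut_inj.
(* The map [diag_aut r] does not depend on the cocycle, so it lies in every automorphism group at
   once. *)
have autP r : is_aut_all (diag_aut r : linaut (vsp R (gT * gT)%type)).
  apply/asboolP => w; apply/asboolP.
  exact: diagonal_quasi_hopf (diag_autE r) _.
pose F r : aut_all R gT := AutAll (autP r).
have FM : {morph F : r s / (r * s)%g} by move=> r s; apply/val_inj/diag_autM.
exists (HB.pack_for {multiplicative charhom R gT -> aut_all R gT} F
  (isMultiplicative.Build _ _ F FM)).
by move=> r s /(congr1 val)/diag_aut_inj.
Qed.
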